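(* Let $A \in \mathbb{Z}^{m \times m}$ and define the sequence $(S_n)_{n \in \mathbb{N}}$, where $S_n$ is the Smith form (over $\mathbb{Z}$) of $A^n$ normalized to have nonnegative diagonal entries. Then there exists an eventually periodic sequence $(D_n)_{n \in \mathbb{N}} \subset \mathbb{Z}^{m \times m}$ of diagonal matrices such that $S_{n+1} = D_n S_n$ for all $n \in \mathbb{N}$.
   Context: $\mathbb{N} = \{0,1,2,\dots\}$. A square matrix over $\mathbb{Z}$ is unimodular if its determinant is $\pm 1$. The Smith form of $M \in \mathbb{Z}^{m\times m}$ is the diagonal matrix $S$ with $S_{ii} \mid S_{i+1,i+1}$ for $1 \le i \le m-1$ such that $M = USV$ for some unimodular $U, V \in \mathbb{Z}^{m\times m}$; it is unique once its diagonal entries are required to be nonnegative (zero diagonal entries are allowed). A sequence $(f(n))_{n\in\mathbb{N}}$ is eventually periodic if there exist $n_0 \in \mathbb{N}$ and an integer $T>0$ such that $f(n+T)=f(n)$ for all $n \ge n_0$. *)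

(* Defs.v *)
From HB Require Import structures.
From mathcomp Require Import all_boot all_order all_algebra.

Set Implicit Arguments.
Unset Strict Implicit.
Unset Printing Implicit Defensive.

Import Order.TTheory GRing.Theory Num.Theory.
Local Open Scope ring_scope.

Definition unimodular (m : nat) (U : 'M[int]_m) : Prop :=
  \det U = 1 \/ \det U = -1.

(* [dvdz] satisfies [(d %| 0)%Z] for every [d], and [(0 %| d)%Z] only for
   [d = 0], so zero diagonal entries are allowed and come last. *)
Definition is_smith_form (m : nat) (M S : 'M[int]_m) : Prop :=
  [/\ is_diag_mx S,
      forall i j : 'I_m, j = i.+1 :> nat -> (S i i %| S j j)%Z,
      forall i : 'I_m, 0 <= S i i
    & exists U V : 'M[int]_m,
        [/\ unimodular U, unimodular V & M = U *m S *m V]].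

Definition eventually_periodic (T : Type) (f : nat -> T) : Prop :=
  exists (n0 p : nat),
    (0 < p)%N /\ forall n : nat, (n0 <= n)%N -> f (n + p)%N = f n.

Lemma unitmx_unimodular (m : nat) (U : 'M[int]_m) :
  U \in unitmx -> unimodular U.
Proof. by rewrite unitmxE => /pred2P. Qed.

Lemma smith_form_exists (m : nat) (M : 'M[int]_m) :
  exists S : 'M[int]_m, is_smith_form M S.
Proof.
have [L uL [R uR [d sd ->]]] := int_Smith_normal_form M.
pose sgn (x : int) : int := if x < 0 then -1 else 1.
have sgnK x : `|x| * sgn x = x.
  rewrite /sgn; case: ltrP => [x0|x0]; last by rewrite mulr1 ger0_norm.
  by rewrite mulrN1 ltr0_norm // opprK.
pose e : 'rV[int]_m := \row_i `|d`_i|.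
pose s : 'rV[int]_m := \row_i sgn d`_i.
exists (diag_mx e); split.
- exact: diag_mx_is_diag.
- move=> i j ji; rewrite !mxE !eqxx !mulr1n ji dvdzE -!abszE !absz_nat.
  have [sz|sz] := ltnP i.+1 (size d); last by rewrite [d`_i.+1]nth_default ?dvdn0.
  exact: (sortedP 0 sd).
- by move=> i; rewrite !mxE eqxx mulr1n normr_ge0.
exists L, (diag_mx s *m R); split.
- exact: unitmx_unimodular.
- apply: unitmx_unimodular; rewrite unitmx_mul uR andbT unitmxE det_diag.
  by apply: rpred_prod => i _; rewrite mxE /sgn; case: ifP.
rewrite !mulmxA; congr (_ *m _); rewrite -mulmxA; congr (_ *m _).
apply/matrixP => i j; rewrite mul_diag_mx !mxE mulrnAr val_eqE.
by have [->|] := eqVneq i j; rewrite ?mulr0n // !mulr1n sgnK.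
Qed.

(* Main.v *)
Require Import Defs.
From HB Require Import structures.
From mathcomp Require Import all_boot all_order all_fingroup all_algebra all_field.
From mathcomp Require Import zify ring.

Set Implicit Arguments.
Unset Strict Implicit.
Unset Printing Implicit Defensive.

Import Order.TTheory GRing.Theory Num.Theory.
Local Open Scope ring_scope.

(* The product [P_k(n)] of the first [k] diagonal entries of [S_n] is the gcd of
   the [k]-minors of [A ^+ n], that is, up to powers of [k`!], the content of the
   [n]-th power of the matrix [B] of all [k]-minors of [A].  So it suffices to
   understand the [p]-adic valuation [v(n)] of the content of [B ^+ n].

   Let [c_j] be the coefficient of degree [N - j] of the characteristic polynomial
   of [B] (of size [N]) and let [a / e] be the least [v(c_j) / j], [j > 0].  By
   Cayley-Hamilton [v(n) >= (a / e) n - O(1)], and by integrality of eigenvalues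
   [v(n) <= (a / e) n].  Thus [B ^+ n / p ^ (a n / e)] has bounded denominators and
   never vanishes modulo a fixed power of [p]; a pigeonhole argument modulo such a
   power makes [v(n) - (a / e) n] eventually periodic.  Only the prime divisors of
   the nonzero [c_j] matter, so some [T] satisfies [c * P_k(n + T) = c' * P_k(n)]
   for large [n]; the same then holds for each diagonal entry of [S_n], and
   the quotients of consecutive entries are periodic. *)

(** * Contents and characteristic coefficients *)

Definition mx_content (m n : nat) (M : 'M[int]_(m, n)) : nat :=
  \big[gcdn/0%N]_(ij : 'I_m * 'I_n) `|M ij.1 ij.2|%N.

Lemma dvdn_content (d m n : nat) (M : 'M[int]_(m, n)) :
  (d %| mx_content M)%N <-> forall i j, (d %| M i j)%Z.
Proof.
split=> [/dvdn_biggcdP dM i j | dM]; first by have := dM (i, j) isT.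
by apply/dvdn_biggcdP => -[i j] _; exact: dM.
Qed.

Lemma mx_contentZ (a m n : nat) (M : 'M[int]_(m, n)) :
  mx_content (a%:Z *: M) = (a * mx_content M)%N.
Proof.
rewrite /mx_content [RHS](big_morph (muln a) (muln_gcdr a) (muln0 a)).
by apply: eq_bigr => ij _; rewrite mxE abszM.
Qed.

Lemma mx_content_divK (d m n : nat) (M : 'M[int]_(m, n)) :
  (d %| mx_content M)%N -> d%:Z *: map_mx (divz^~ d%:Z) M = M.
Proof.
move=> /dvdn_content dM; apply/matrixP => i j.
by rewrite !mxE mulrC divzK.
Qed.

Lemma dvdn_contentP (d m n : nat) (M : 'M[int]_(m, n)) :
  (d %| mx_content M)%N <-> exists C : 'M[int]_(m, n), M = d%:Z *: C.
Proof.
split=> [dM | [C ->]]; last by rewrite mx_contentZ dvdn_mulr.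
by exists (map_mx (divz^~ d%:Z) M); rewrite mx_content_divK.
Qed.

(** Up to sign, the [j]-th elementary symmetric function of the eigenvalues when [j <= n]. *)
Definition char_coef (n : nat) (B : 'M[int]_n) (j : nat) : int :=
  (char_poly B)`_(n - j).

Lemma Aint_expr_inv (x : algC) (k : nat) :
  (0 < k)%N -> x ^+ k \in Aint -> x \in Aint.
Proof.
move=> k0 xA; apply: (@root_monic_Aint (minCpoly (x ^+ k) \Po 'X^k)).
- by rewrite /root horner_comp hornerXn; exact: root_minCpoly.
- rewrite monicE lead_coef_comp ?size_polyXn //.
  by rewrite lead_coefXn expr1n mulr1 -monicE minCpoly_monic.
- by apply: polyOver_comp => //; rewrite rpredX ?polyOverX.
Qed.

Lemma coef_prod_XsubC_scale (R : comNzRingType) (a : R) (r : seq R) (i : nat) :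
  (\prod_(z <- r) ('X - (a * z)%:P))`_i =
  a ^+ (size r - i) * (\prod_(z <- r) ('X - z%:P))`_i.
Proof.
elim: r i => [|z r IH] i; first by rewrite !big_nil mul1r.
rewrite !big_cons !mulrBl !coefB !coefCM.
case: i => [|i]; rewrite !(coefXM, IH) /= ?subn0 ?subSS.
  by rewrite exprS; ring.
have [ir|ri] := ltnP i (size r).
  by rewrite -(subnSK ir) exprS; ring.
have -> : (\prod_(z <- r) ('X - z%:P))`_i.+1 = 0.
  by rewrite nth_default // size_prod_XsubC ltnS.
by rewrite !mulr0 !subr0.
Qed.

(* If [g] divides [B ^+ k], then [l ^+ k / g] is an algebraic integer for every
   eigenvalue [l] of [B], hence so is [l / r] where [r ^+ k = g]; and the
   [j]-th coefficient is homogeneous of degree [j] in the eigenvalues. *)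
Lemma dvd_char_coef (g n k j : nat) (B : 'M[int]_n) :
  (0 < g)%N -> (0 < k)%N -> (j <= n)%N -> (g %| mx_content (B ^+ k))%N ->
  (g%:Z ^+ j %| char_coef B j ^+ k)%Z.
Proof.
move=> g0 k0 jn /dvdn_contentP[C BkC].
pose toC : {rmorphism int -> algC} := intr.
have [r charB] := closed_field_poly_normal (char_poly (map_mx toC B)).
rewrite (monicP (char_poly_monic _)) scale1r in charB.
have size_r : size r = n.
  by apply: succn_inj; rewrite -(size_char_poly (map_mx toC B)) charB size_prod_XsubC.
pose q : algC := k.-root g%:R.
have qk : q ^+ k = g%:R by rewrite rootCK.
have q_neq0 : q != 0 by rewrite rootC_eq0 // pnatr_eq0 -lt0n.
have rA z : z \in r -> z / q \in Aint.
  move=> zr; apply: (Aint_expr_inv k0); rewrite expr_div_n qk.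
  have : root (char_poly (map_mx toC B)) z by rewrite charB root_prod_XsubC.
  rewrite -eigenvalue_root_char => /eigenvalueP[v vB v0].
  have vBk i : v *m map_mx toC (B ^+ i) = z ^+ i *: v.
    elim: i => [|i IH]; first by rewrite map_mx1 mulmx1 scale1r.
    by rewrite exprSr map_mxM mulmxA IH -scalemxAl vB scalerA -exprSr.
  apply: (@root_monic_Aint (char_poly (map_mx toC C))).
  - rewrite -eigenvalue_root_char; apply/eigenvalueP; exists v => //.
    have gC0 : g%:R != 0 :> algC by rewrite pnatr_eq0 -lt0n.
    apply: (scalerI gC0); rewrite scalerA mulrCA divff // mulr1 -vBk BkC.
    by rewrite map_mxZ scalemxAr.
  - exact: char_poly_monic.
  - rewrite -map_char_poly; apply/polyOverP => i; rewrite coef_map.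
    by rewrite intr_int.
pose c : algC := (\prod_(z <- [seq z / q | z <- r]) ('X - z%:P))`_(n - j).
have cA : c \in Aint.
  suff /polyOverP -> : \prod_(z <- [seq z / q | z <- r]) ('X - z%:P)
    \is a polyOver Aint by [].
  rewrite big_map big_seq; apply: rpred_prod => z zr.
  by rewrite polyOverXsubC rA.
have cE : toC (char_coef B j) = q ^+ j * c.
  have jE : j = (size [seq (z / q)%R | z <- r] - (n - j))%N.
    by rewrite size_map size_r subKn.
  rewrite -[LHS]coef_map map_char_poly charB /c [in q ^+ _]jE.
  rewrite -coef_prod_XsubC_scale big_map.
  by congr (polyseq _)`_ _; apply: eq_bigr => z _; rewrite mulrC divfK.
have : c ^+ k \is a Num.int.
  apply: Cint_rat_Aint; last exact: rpredX.
  have -> : c ^+ k = (char_coef B j ^+ k)%:~R / (g ^ j)%N%:R.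
    rewrite rmorphXn /= [_%:~R]cE exprMn exprAC qk natrX mulrC mulKf //.
    by rewrite expf_neq0 // pnatr_eq0 -lt0n.
  by rewrite rpred_div ?rpred_int ?rpred_nat.
case/intrP => w cw; apply/dvdzP; exists w; apply: (@intr_inj algC).
by rewrite rmorphXn /= [_%:~R]cE exprMn exprAC qk cw rmorphM rmorphXn mulrC.
Qed.

Lemma expr_char_coef (n k : nat) (B : 'M[int]_n.+1) :
  (n < k)%N ->
  B ^+ k = - \sum_(j < n.+1) char_coef B j.+1 *: B ^+ (k - j.+1).
Proof.
move=> nk; have := Cayley_Hamilton B.
rewrite -[char_poly B]coefK poly_def rmorph_sum size_char_poly big_ord_recr /=.
have -> : (char_poly B)`_n.+1 = 1.
  by have /monicP := char_poly_monic B; rewrite lead_coefE size_char_poly.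
rewrite scale1r rmorphXn /= horner_mx_X => /(congr1 ( *%R^~ (B ^+ (k - n.+1)))).
rewrite mul0r mulrDl -exprD subnKC // addrC => /eqP; rewrite addr_eq0 => /eqP ->.
congr (- _); rewrite mulr_suml (reindex_inj rev_ord_inj) /=.
apply: eq_bigr => j _; rewrite linearZ rmorphXn /= horner_mx_X.
rewrite -scalerAl -exprD /char_coef.
by congr (_ *: _ ^+ _); have := ltn_ord j; lia.
Qed.

(** The hypothesis puts the ceiling of [a * j / e] below the valuation of the [j]-th coefficient.
    Induction on [k] follows the Cayley-Hamilton recurrence; [p ^ (a * n.+1)] pays for the initial
    exponents [k <= n]. *)
Lemma expr_divide (n p e a k : nat) (B : 'M[int]_n.+1) :
  (0 < e)%N ->
  (forall j t, (0 < j <= n.+1)%N -> (e * t < a * j + e)%N ->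
     ((p ^ t)%N %| char_coef B j)%Z) ->
  (p ^ (a * k %/ e) %| mx_content ((p ^ (a * n.+1))%N%:Z *: B ^+ k))%N.
Proof.
move=> e0 pc; elim/ltn_ind: k => k IH.
have [nk|kn] := ltnP n k; last first.
  rewrite mx_contentZ dvdn_mulr // dvdn_exp2l //.
  by apply: leq_trans (leq_div _ _) _; rewrite leq_mul2l leqW ?orbT.
rewrite expr_char_coef //; apply/dvdn_content => u v.
rewrite scalerN mxE rpredN scaler_sumr summxE; apply: rpred_sum => j _.
rewrite scalerA mulrC -scalerA mxE.
have jk : (k - j.+1 < k)%N by lia.
have /dvdn_content/(_ u v) := IH _ jk; set M := (X in fun_of_matrix X) => dvM.
(* The floor of [a * k / e] grows by at most the ceiling of [a * j.+1 / e]. *)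
pose t := (a * k %/ e - a * (k - j.+1) %/ e)%N.
have ltt : (e * t < a * j.+1 + e)%N.
  rewrite /t mulnBr.
  have := leq_divM (a * k) e; have := @ltn_ceil (a * (k - j.+1)) e e0.
  have := ltn_ord j; nia.
have := dvdz_mul (pc j.+1 t _ ltt) dvM; rewrite ltn_ord => /(_ isT).
apply: dvdz_trans.
rewrite -PoszM -expnD; apply: dvdn_exp2l; rewrite /t; lia.
Qed.

Lemma content_pigeonhole (q n : nat) (X : nat -> 'M[int]_n) :
  (0 < q)%N ->
  exists i l, (0 < l)%N /\ (q %| mx_content (X (i + l)%N - X i))%N.
Proof.
case: q => // q _.
pose s i : 'M['I_q.+1]_n := \matrix_(u, v) inord (absz (X i u v %% q.+1)%Z).
pose T := 'M['I_q.+1]_n.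
have /injectivePn[x [y xy sxy]] : ~~ injectiveb (fun i : 'I_#|T|.+1 => s i).
  apply/injectiveP => /leq_card; by rewrite card_ord ltnn.
have main (i j : nat) : (i < j)%N -> s i = s j ->
    exists i l, (0 < l)%N /\ (q.+1 %| mx_content (X (i + l)%N - X i))%N.
  move=> ij sij; exists i, (j - i)%N; split; first by rewrite subn_gt0.
  rewrite subnKC 1?ltnW //; apply/dvdn_content => u v.
  have /matrixP/(_ u v)/(congr1 (@nat_of_ord _)) := sij.
  have lt_q k : (absz (X k u v %% q.+1)%Z < q.+1)%N.
    by rewrite -ltz_nat gez0_abs ?modz_ge0 // ltz_pmod.
  rewrite !mxE !inordK // => /(congr1 Posz); rewrite !gez0_abs ?modz_ge0 // => E.
  by rewrite -eqz_mod_dvd; apply/eqP.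
have [lt_xy|lt_yx|/val_inj eq_xy] := ltngtP x y.
- exact: main lt_xy sxy.
- exact: main lt_yx (esym sxy).
by rewrite eq_xy eqxx in xy.
Qed.

Lemma scalemx_inj (R : idomainType) (m n : nat) (a : R) :
  a != 0 -> injective ( *:%R a : 'M[R]_(m, n) -> 'M[R]_(m, n)).
Proof.
move=> a0 M N /matrixP MN; apply/matrixP => i j.
by apply: (mulfI a0); have := MN i j; rewrite !mxE.
Qed.

Lemma divn_mulDr (a e i r : nat) :
  (0 < e)%N -> (a * (e * i + r) %/ e = a * i + a * r %/ e)%N.
Proof.
by move=> e0; rewrite mulnDr mulnA [(a * e)%N]mulnC -mulnA [(e * _)%N]mulnC divnMDl.
Qed.

(** Along multiples of [e] the slope is exact: [B ^+ (e * i) / p ^ (a * i)] has denominator at most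
    [p ^ c], and pigeonhole applies. Multiplying by [B ^+ r] reaches the other exponents. *)
Lemma exprM_content_periodic (n p e a c : nat) (B : 'M[int]_n) :
  (0 < p)%N -> (0 < e)%N ->
  (forall k, (p ^ (a * k %/ e) %| mx_content ((p ^ c)%N%:Z *: B ^+ k))%N) ->
  exists k0 l, (0 < l)%N /\ forall k, (k0 <= k)%N ->
    (p ^ (a * k %/ e + a * l + 1) %|
       mx_content (B ^+ (k + e * l) - (p ^ (a * l))%N%:Z *: B ^+ k))%N.
Proof.
move=> p0 e0 pB; pose P i : int := (p ^ i)%N.
have PD i j : P (i + j)%N = P i * P j by rewrite /P expnD PoszM.
have P_neq0 i : P i != 0 by rewrite eqz_nat -lt0n expn_gt0 p0.
pose X i := map_mx (divz^~ (P (a * i)%N)) (P c *: B ^+ (e * i)).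
have XE i : P (a * i)%N *: X i = P c *: B ^+ (e * i).
  apply: mx_content_divK; have := pB (e * i)%N.
  by rewrite mulnCA mulKn.
(* One [c] clears the denominator of [X], the other that of [B ^+ r]; the spare 1 makes the
   congruence finer than the valuations to be compared. *)
have q0 : (0 < p ^ (c + c + 1))%N by rewrite expn_gt0 p0.
have [i [l [l0 /dvdn_contentP[Z XZ]]]] := content_pigeonhole X q0.
have {}XZ : X (i + l)%N = X i + P (c + c + 1)%N *: Z by rewrite -XZ addrC subrK.
exists (e * i)%N, l; split=> // k /subnKC; set r := (k - e * i)%N => <-.
have /dvdn_contentP[W BrW] := pB r.
apply/dvdn_contentP; exists (Z *m W).
rewrite divn_mulDr //.
have -> : (e * i + r + e * l = e * (i + l) + r)%N by lia.
have BrWP : P c *: B ^+ r = P (a * r %/ e)%N *: W := BrW.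
rewrite -[LHS]/(B ^+ (e * (i + l) + r) - P (a * l)%N *: B ^+ (e * i + r)).
rewrite -[RHS]/(P (a * i + a * r %/ e + a * l + 1)%N *: (Z *m W)).
apply: (scalemx_inj (P_neq0 c)); rewrite scalerBr !exprD -!mulmxE.
rewrite [P c *: (P (a * l)%N *: _)]scalerA [P c * P (a * l)%N]mulrC -scalerA.
rewrite !scalemxAl -!XE XZ scalerDr !scalerA -!PD -mulnDr addnC mulnDr.
rewrite mulmxDl addrC addKr -scalemxAl.
have -> : (a * l + a * i + (c + c + 1) = (a * i + a * l + c + 1) + c)%N by lia.
rewrite PD -scalerA -!scalemxAl scalemxAr BrWP -scalemxAr scalerA -PD.
by congr (P _ *: _); lia.
Qed.

(** * Contents of the powers of a matrix *)

(** Serves twice: over the primes dividing a coefficient, and over the sizes of minors. *)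
Lemma common_period (I : eqType) (r : seq I) (Q : I -> nat -> nat -> Prop) :
  (forall i k0 k1 T l, Q i k0 T -> (k0 <= k1)%N -> (0 < l)%N -> Q i k1 (l * T)%N) ->
  {in r, forall i, exists k0 T, (0 < T)%N /\ Q i k0 T} ->
  exists k0 T, (0 < T)%N /\ {in r, forall i, Q i k0 T}.
Proof.
move=> Qmono; elim: r => [|x r IH] Qr; first by exists 0%N, 1%N.
have [k1 [T1 [T1_gt0 Q1]]] := Qr x (mem_head x r).
have [i ir|k2 [T2 [T2_gt0 Q2]]] := IH; first by apply: Qr; rewrite inE ir orbT.
exists (maxn k1 k2), (T2 * T1)%N; split=> [|i]; first by rewrite muln_gt0 T2_gt0.
rewrite inE => /predU1P[->|ir]; first exact: Qmono Q1 (leq_maxl _ _) T2_gt0.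
by rewrite mulnC; apply: Qmono (Q2 i ir) (leq_maxr _ _) T1_gt0.
Qed.

Lemma content_expr_dvd (n k j : nat) (B : 'M[int]_n) :
  (0 < k)%N -> (0 < j <= n)%N -> char_coef B j != 0 ->
  (0 < mx_content (B ^+ k))%N /\
  (mx_content (B ^+ k) ^ j %| `|char_coef B j| ^ k)%N.
Proof.
move=> k0 /andP[j0 jn] c0.
have dvd_c g : (0 < g)%N -> (g %| mx_content (B ^+ k))%N ->
    (g ^ j %| `|char_coef B j| ^ k)%N.
  move=> g0 gB; rewrite -abszX.
  by have := dvd_char_coef g0 k0 jn gB; rewrite dvdzE abszX.
have ck_gt0 : (0 < `|char_coef B j| ^ k)%N by rewrite expn_gt0 absz_gt0 c0.
have cont0 : (0 < mx_content (B ^+ k))%N.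
  rewrite lt0n; apply/negP => /eqP B0.
  have := dvd_c (`|char_coef B j| ^ k).+1 (ltn0Sn _); rewrite B0 dvdn0 => /(_ isT).
  move=> /(dvdn_trans (dvdn_exp j0 (dvdnn _))) /(dvdn_leq ck_gt0).
  by rewrite ltnn.
by split=> //; exact: dvd_c.
Qed.

Lemma logn_content_periodic (n p j : nat) (B : 'M[int]_n) :
  prime p -> (0 < j <= n)%N -> char_coef B j != 0 ->
  exists k0 T, (0 < T)%N /\ exists b, forall k, (k0 <= k)%N ->
    logn p (mx_content (B ^+ (k + T))) = (logn p (mx_content (B ^+ k)) + b)%N.
Proof.
case: n B => [|n] B pp; first by rewrite leqn0 => /andP[/lt0n_neq0/negPf->].
move=> jn cj0; have p0 := prime_gt0 pp.
pose v (i : 'I_n.+1) : nat := logn p `|char_coef B i.+1|.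
have jn1 : (j.-1 < n.+1)%N by lia.
pose i0 := Ordinal jn1.
have ci0 : char_coef B i0.+1 != 0 by rewrite prednK //; lia.
have [i ci imin] := @arg_minP _ rat _ i0 (fun i : 'I_n.+1 => char_coef B i.+1 != 0)
  (fun i => (v i)%:R / i.+1%:R) ci0.
(* The fraction is left unreduced: [e] is the index of the coefficient, so [content_expr_dvd] at [e]
   yields [Bup] directly. *)
pose e := i.+1; pose a := v i.
have min_slope (h : 'I_n.+1) : char_coef B h.+1 != 0 -> (a * h.+1 <= e * v h)%N.
  move=> ch; have := imin h ch.
  rewrite ler_pdivrMr ?ltr0Sn // mulrAC ler_pdivlMr ?ltr0Sn //.
  by rewrite -!natrM ler_nat mulnC [(_ * i.+1)%N]mulnC mulnC.
have Bdvd k := @expr_divide n p e a k B (ltn0Sn _) _.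
have {}Bdvd k : (p ^ (a * k %/ e) %|
    mx_content ((p ^ (a * n.+1))%N%:Z *: B ^+ k))%N.
  apply: Bdvd => -[//|h] t; rewrite ltnS => hn ht.
  have [->|ch] := eqVneq (char_coef B h.+1) 0; first exact: dvdz0.
  rewrite dvdzE /= pfactor_dvdn ?absz_gt0 //.
  have := min_slope (Ordinal (hn : (h < n.+1)%N)) ch; rewrite /v /=; nia.
have [k0 [l [l0 Bper]]] := exprM_content_periodic p0 (ltn0Sn i) Bdvd.
have Bup k : (0 < k)%N -> (0 < mx_content (B ^+ k))%N /\
    (logn p (mx_content (B ^+ k)) <= a * k %/ e)%N.
  move=> k_gt0; have [] := @content_expr_dvd _ k e B k_gt0 _ ci; first exact: ltn_ord.
  move=> c0 cdvd; split=> //; rewrite leq_divRL // mulnC -lognX mulnC.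
  by rewrite -lognX dvdn_leq_log // expn_gt0 absz_gt0 ci.
exists k0.+1, (e * l)%N; split; first by rewrite muln_gt0.
exists (a * l)%N => k k0k; have k_gt0 : (0 < k)%N by lia.
have kT_gt0 : (0 < k + e * l)%N by lia.
have [c1 v1] := Bup k k_gt0; have [c2 v2] := Bup _ kT_gt0.
have := Bper k (ltnW k0k); set s := (_ + 1)%N.
set M := B ^+ _ => MN; pose N := (p ^ (a * l))%N%:Z *: B ^+ k.
have vN : logn p (mx_content N) = (logn p (mx_content (B ^+ k)) + a * l)%N.
  by rewrite mx_contentZ lognM ?expn_gt0 ?p0 // pfactorK // addnC.
have cN : (0 < mx_content N)%N by rewrite mx_contentZ muln_gt0 expn_gt0 p0.
have {}v2 : (logn p (mx_content M) < s)%N.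
  rewrite /s addn1 ltnS; apply: leq_trans v2 _.
  by rewrite [(k + _)%N]addnC divn_mulDr // addnC.
have {}v1 : (logn p (mx_content N) < s)%N by rewrite vN /s addn1 ltnS leq_add2r.
rewrite -vN; apply/eqP; rewrite eqn_leq.
(* [M] and [N] agree modulo [p ^ s] and both contents have valuation below [s], so the valuations
   coincide. *)
have step (t : nat) (M' N' : 'M[int]_n.+1) : (t < s)%N ->
    (p ^ s %| mx_content (M' - N'))%N -> (p ^ t %| mx_content M')%N ->
    (p ^ t %| mx_content N')%N.
  move=> ts /dvdn_content dMN /dvdn_content dM; apply/dvdn_content => x y.
  have -> : N' x y = M' x y - (M' - N') x y by rewrite !mxE; ring.
  apply: rpredB => //; apply: dvdz_trans (dMN x y).
  by rewrite dvdzE /= dvdn_exp2l // ltnW.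
have MN' : (p ^ s %| mx_content (N - M))%N.
  apply/dvdn_content => x y; have /dvdn_content/(_ x y) := MN.
  by rewrite -rpredN !mxE opprB.
apply/andP; split.
- rewrite -pfactor_dvdn //; exact: step v2 MN (pfactor_dvdnn _ _).
- rewrite -pfactor_dvdn //; exact: step v1 MN' (pfactor_dvdnn _ _).
Qed.

(** A constant rational ratio [c2 / c1], cleared of denominators so that vanishing terms are
    allowed. *)
Definition geometric_along (u : nat -> nat) (k0 T : nat) : Prop :=
  exists c1 c2, [/\ (0 < c1)%N, (0 < c2)%N &
    forall k, (k0 <= k)%N -> (c1 * u (k + T) = c2 * u k)%N].

Lemma geometric_alongM (u : nat -> nat) (k0 k1 T l : nat) :
  geometric_along u k0 T -> (k0 <= k1)%N -> (0 < l)%N ->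
  geometric_along u k1 (l * T).
Proof.
move=> [c1 [c2 [c1_gt0 c2_gt0 uT]]] k01 _; exists (c1 ^ l)%N, (c2 ^ l)%N.
rewrite !expn_gt0 c1_gt0 c2_gt0; split=> // k k1k.
elim: l => [|l IH]; first by rewrite mul0n addn0.
by rewrite mulSnr addnA !expnS mulnAC uT ?mulnA; nia.
Qed.

(** Either [B] is nilpotent, or a nonzero coefficient confines the primes of the contents to its own
    divisors. *)
Lemma content_expr_geometric (n : nat) (B : 'M[int]_n) :
  exists k0 T, (0 < T)%N /\ geometric_along (fun k => mx_content (B ^+ k)) k0 T.
Proof.
have eventually0 : (forall k, (n <= k)%N -> mx_content (B ^+ k) = 0%N) ->
    exists k0 T, (0 < T)%N /\ geometric_along (fun k => mx_content (B ^+ k)) k0 T.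
  move=> B0; exists n, 1%N; split=> //; exists 1%N, 1%N; split=> // k nk.
  by rewrite !B0 ?(leq_trans nk) ?leq_addr.
have [/existsP[j cj]|/existsPn c0] :=
    boolP [exists j : 'I_n, char_coef B j.+1 != 0]; last first.
  apply: eventually0 => k nk; apply/eqP; rewrite -dvd0n.
  case: n B c0 nk => [|n] B c0 nk; apply/dvdn_content => u v; first by case: u.
  rewrite expr_char_coef // big1 ?oppr0 ?mxE // => j _.
  by have /negPn/eqP -> := c0 j; rewrite scale0r.
have jn : (0 < j.+1 <= n)%N := ltn_ord j.
pose u k := mx_content (B ^+ k).
pose Q p k0 T := exists b, forall k, (k0 <= k)%N ->
  logn p (u (k + T)%N) = (logn p (u k) + b)%N.
have Qmono p k0 k1 T l : Q p k0 T -> (k0 <= k1)%N -> (0 < l)%N -> Q p k1 (l * T)%N.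
  move=> [b pb] k01 _; exists (l * b)%N => k k1k.
  elim: l => [|l IH]; first by rewrite !mul0n !addn0.
  by rewrite !mulSnr !addnA pb ?IH //; lia.
have [p|k0 [T [T0 uT]]] := @common_period _ (primes `|char_coef B j.+1|) Q Qmono.
  rewrite mem_primes => /andP[pp _].
  have [k0 [T [T0 H]]] := logn_content_periodic pp jn cj.
  by exists k0, T.
have u_gt0 k : (0 < k)%N -> (0 < u k)%N.
  by move=> k_gt0; case: (content_expr_dvd k_gt0 jn cj).
(* The ratio is read off at [k0.+1], a positive exponent, where the content is known to be
   nonzero. *)
exists k0.+1, T; split=> //; exists (u k0.+1), (u (k0.+1 + T)%N).
split; rewrite ?u_gt0 ?addn_gt0 // => k k0k.
have k_gt0 : (0 < k)%N by lia.
have kT_gt0 : (0 < k + T)%N by lia.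
apply: eqn_from_log; rewrite ?muln_gt0 ?u_gt0 // => p.
rewrite !lognM ?u_gt0 //.
have [pc|pc] := boolP (p \in primes `|char_coef B j.+1|).
  have [b pb] := uT p pc; rewrite -/(u k) -/(u (k + T)%N).
  rewrite (pb k (ltnW k0k)) (pb k0.+1 (leqnSn k0)); lia.
have logn0 i : (0 < i)%N -> logn p (u i) = 0%N.
  move=> i_gt0; apply/eqP; apply: contraR pc; rewrite -lt0n logn_gt0 !mem_primes.
  move=> /and3P[pp _ pu]; rewrite pp absz_gt0 cj /=.
  have [_ ui] := content_expr_dvd i_gt0 jn cj.
  by have := dvdn_trans (dvdn_exp (ltn0Sn j) pu) ui; rewrite Euclid_dvdX // => /andP[].
by rewrite !logn0.
Qed.

(** * Minors *)

(** Multilinearity in the rows: row [f i] of [A *m B] is a combination of the rows of [B]. *)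
Lemma det_mxsub_mul (R : comNzRingType) (k m n p : nat)
    (f : 'I_k -> 'I_m) (g : 'I_k -> 'I_p) (A : 'M[R]_(m, n)) (B : 'M[R]_(n, p)) :
  \det (mxsub f g (A *m B)) =
  \sum_(h : {ffun 'I_k -> 'I_n}) (\prod_i A (f i) (h i)) * \det (mxsub h g B).
Proof.
rewrite /determinant.
under eq_bigr => s _.
  under eq_bigr => i _ do rewrite !mxE.
  rewrite bigA_distr_bigA /= mulr_sumr; over.
rewrite exchange_big; apply: eq_bigr => h _; rewrite mulr_sumr.
apply: eq_bigr => s _; rewrite big_split /= mulrCA; congr (_ * (_ * _)).
by apply: eq_bigr => i _; rewrite !mxE.
Qed.

(* The sum runs over all maps [h], so each increasing one of the Cauchy-Binet
   formula is counted [k`!] times. *)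
Lemma cauchy_binet_ffun (R : comNzRingType) (k m n p : nat)
    (f : 'I_k -> 'I_m) (g : 'I_k -> 'I_p) (A : 'M[R]_(m, n)) (B : 'M[R]_(n, p)) :
  \sum_(h : {ffun 'I_k -> 'I_n}) \det (mxsub f h A) * \det (mxsub h g B) =
  \det (mxsub f g (A *m B)) *+ k`!.
Proof.
rewrite -card_Sn -sumr_const.
under eq_bigr => h _ do rewrite {1}/determinant mulr_suml.
rewrite exchange_big; apply: eq_bigr => s _; rewrite det_mxsub_mul.
(* Composing [h] with the inverse of [s] squares the sign away, so every permutation contributes the
   same determinant. *)
pose c (h : {ffun 'I_k -> 'I_n}) := [ffun i => h (s^-1 i)%g].
have c_inj : injective c.
  move=> h1 h2 /ffunP h12; apply/ffunP => i.
  by have := h12 (s i); rewrite !ffunE permK.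
rewrite (reindex_inj c_inj); apply: eq_bigr => h _.
have -> : mxsub (c h) g B = row_perm s^-1 (mxsub h g B).
  by apply/matrixP => i j; rewrite !mxE ffunE.
rewrite row_permE det_mulmx det_perm odd_permV mulrACA -expr2 sqrr_sign mul1r.
by congr (_ * _); apply: eq_bigr => i _; rewrite !mxE ffunE permK.
Qed.

Lemma det_mxsub_not_inj (R : comNzRingType) (k m n : nat)
    (f : 'I_k -> 'I_m) (g : 'I_k -> 'I_n) (A : 'M[R]_(m, n)) :
  ~ injective f -> \det (mxsub f g A) = 0.
Proof.
move=> /injectiveP/injectivePn[i [j ij fij]].
by apply: (determinant_alternate ij) => l; rewrite !mxE fij.
Qed.

(** A redundant compound matrix: indexing by all maps, not only increasing ones, adds just zeros and
    signed repetitions, which leave the content unchanged. *)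
Definition minors_mx (k m : nat) (A : 'M[int]_m) :
    'M[int]_#|{ffun 'I_k -> 'I_m}| :=
  \matrix_(f, g) \det (mxsub (enum_val f : {ffun _ -> _})
                             (enum_val g : {ffun _ -> _}) A).

Lemma minors_mxM (k m : nat) (A B : 'M[int]_m) :
  minors_mx k A *m minors_mx k B = k`!%:Z *: minors_mx k (A *m B).
Proof.
apply/matrixP => f g; rewrite !mxE -[Posz _]natz mulr_natl -cauchy_binet_ffun.
rewrite [RHS](reindex _ (onW_bij _ (enum_val_bij {ffun 'I_k -> 'I_m}))) /=.
by apply: eq_bigr => h _; rewrite !mxE.
Qed.

Lemma minors_mxX (k m l : nat) (A : 'M[int]_m) :
  minors_mx k A ^+ l.+1 = (k`! ^ l)%N%:Z *: minors_mx k (A ^+ l.+1).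
Proof.
elim: l => [|l IH]; first by rewrite !expr1 scale1r.
rewrite exprSr IH -mulmxE -scalemxAl minors_mxM scalerA -PoszM mulnC -expnS.
by rewrite [in RHS]exprSr.
Qed.

Lemma dvdn_minorsP (d k m : nat) (A : 'M[int]_m) :
  (d %| mx_content (minors_mx k A))%N <->
  forall f g : 'I_k -> 'I_m, (d %| \det (mxsub f g A))%Z.
Proof.
rewrite dvdn_content; split=> dA f g; last by rewrite mxE.
have := dA (enum_rank (finfun f)) (enum_rank (finfun g)).
by rewrite mxE !enum_rankK mxsub_ffun.
Qed.

(** Minors of a product are integer combinations of minors of either factor; transposition handles
    [Y]. *)
Lemma dvdn_minors_mul (d k m : nat) (X A Y : 'M[int]_m) :
  (d %| mx_content (minors_mx k A))%N ->
  (d %| mx_content (minors_mx k (X *m A *m Y)))%N.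
Proof.
move=> /dvdn_minorsP dA; apply/dvdn_minorsP => f g.
rewrite -det_tr trmx_mxsub trmx_mul det_mxsub_mul; apply: rpred_sum => h _.
apply: dvdz_mull; rewrite -det_tr trmx_mxsub trmxK det_mxsub_mul.
by apply: rpred_sum => h' _; exact: dvdz_mull.
Qed.

(** An injective [f] on [k.+1] indices takes a value at least [k]; that factor absorbs [s k], and
    induction treats the rest. *)
Lemma prod_chain_dvdn (s : nat -> nat) (k : nat) (f : 'I_k -> nat) :
  (forall i j, (i <= j)%N -> (s i %| s j)%N) -> injective f ->
  (\prod_(i < k) s i %| \prod_(i < k) s (f i))%N.
Proof.
move=> chain; elim: k f => [|k IH] f f_inj; first by rewrite !big_ord0.
have [i0 ki0] : exists i, (k <= f i)%N.
  apply/existsP; apply: contraT => /existsPn small.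
  have fk i : (f i < k)%N by rewrite ltnNge small.
  suff /leq_card : injective (fun i => Ordinal (fk i)) by rewrite !card_ord ltnn.
  by move=> i j /(congr1 val) /f_inj.
rewrite big_ord_recr /= (bigD1_ord i0) //= mulnC dvdn_mul ?chain //.
by apply: (IH (fun i => f (lift i0 i))) => i j /f_inj /lift_inj.
Qed.

(** With entries from a sequence on all of [nat], the same [s] also describes leading blocks. *)
Definition diagn (m : nat) (s : nat -> nat) : 'M[int]_m :=
  diag_mx (\row_(i < m) (s i)%:Z).

(** A Leibniz term vanishes unless it uses diagonal entries only; it is then, up to sign, a product
    of [s] along the injective [f]. *)
Lemma prod_dvdn_minors_diagn (m k : nat) (s : nat -> nat) :
  (forall i j, (i <= j)%N -> (s i %| s j)%N) ->
  (\prod_(i < k) s i %| mx_content (minors_mx k (diagn m s)))%N.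
Proof.
move=> chain; apply/dvdn_minorsP => f g.
have [/injectiveP f_inj|/injectiveP ninj] := boolP (injectiveb f); last first.
  by rewrite det_mxsub_not_inj.
apply: rpred_sum => t _; apply: dvdz_mull.
have [/forallP fg|/forallPn[i fgi]] := boolP [forall i, f i == g (t i)].
  rewrite (eq_bigr (fun i => (s (f i))%:Z)).
    rewrite -(big_morph Posz PoszM (erefl _)).
    apply: (prod_chain_dvdn chain (f := fun i => f i)) => i j /val_inj; exact: f_inj.
  by move=> i _; rewrite !mxE (fg i).
by rewrite (bigD1 i) //= !mxE (negPf fgi) mul0r.
Qed.

(** The leading minor attains the bound; for [k > m] the product contains [s m = 0]. *)
Lemma content_minors_diagn (m k : nat) (s : nat -> nat) :
  (forall i j, (i <= j)%N -> (s i %| s j)%N) ->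
  (forall i, (m <= i)%N -> s i = 0%N) ->
  mx_content (minors_mx k (diagn m s)) = (\prod_(i < k) s i)%N.
Proof.
move=> chain s0; apply/eqP; rewrite eqn_dvd prod_dvdn_minors_diagn // andbT.
have [km|mk] := leqP k m; last first.
  by rewrite (bigD1 (Ordinal mk)) //= s0 // mul0n dvdn0.
set c := mx_content _; have /dvdn_minorsP/(_ (widen_ord km) (widen_ord km)) := dvdnn c.
have -> : mxsub (widen_ord km) (widen_ord km) (diagn m s) = diagn k s.
  by apply/matrixP => i j; rewrite !mxE.
rewrite det_diag (eq_bigr (fun i : 'I_k => (s i)%:Z)) => [|i _]; last by rewrite mxE.
by rewrite -(big_morph Posz PoszM (erefl _)).
Qed.

Lemma det_congr (k : nat) (d : int) (A B : 'M[int]_k) :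
  (forall i j, (d %| A i j - B i j)%Z) -> (d %| \det A - \det B)%Z.
Proof.
move=> AB; rewrite /determinant.
apply: (big_ind2 (fun x y => d %| x - y)%Z); first by rewrite subrr.
  by move=> x1 x2 y1 y2 dx dy; rewrite opprD addrACA rpredD.
move=> t _; rewrite -mulrBr dvdz_mull //.
apply: (big_ind2 (fun x y => d %| x - y)%Z); first by rewrite subrr.
  move=> x1 x2 y1 y2 dx dy.
  have -> : x1 * y1 - x2 * y2 = x1 * (y1 - y2) + y2 * (x1 - x2) by ring.
  by rewrite rpredD ?dvdz_mull.
by move=> i _; exact: AB.
Qed.

Definition dvd_chain (m : nat) (s : nat -> nat) : Prop :=
  (forall i j, (i <= j)%N -> (s i %| s j)%N) /\
  (forall i, (m <= i)%N -> s i = 0%N).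

Lemma mulmx_diagn (m : nat) (s t : nat -> nat) :
  diagn m s *m diagn m t = diagn m (fun i => s i * t i)%N.
Proof.
rewrite /diagn mulmx_diag; congr diag_mx.
by apply/rowP => i; rewrite !mxE PoszM.
Qed.

(* Write [h = t k] and [g = s k].  Scaling columns of the leading block of
   [diagn m t] to [h] and splitting off the entries of [diagn m s] of index
   [>= k], all multiples of [g], exhibits [h%:M - g *: Z] of size [k.+1] as a
   product through rank [k]; so its determinant vanishes, which forces [g %| h]. *)
Lemma dvd_chain_mul (m k : nat) (s t : nat -> nat) (X Y : 'M[int]_m) :
  dvd_chain m s -> dvd_chain m t -> diagn m t = X *m diagn m s *m Y ->
  (s k %| t k)%N.
Proof.
move=> [s_chain s0] [t_chain t0] tXsY.
have [mk|km] := leqP m k; first by rewrite t0.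
have [->|tk_neq0] := eqVneq (t k) 0%N; first exact: dvdn0.
pose low i := if (i < k)%N then s i else 0%N.
pose hi i := if (i < k)%N then 0%N else (s i %/ s k)%N.
pose E := diagn m (fun i => t k %/ t i)%N.
pose f : 'I_k.+1 -> 'I_m := widen_ord km.
have lowhi : diagn m s = diagn m low + (s k)%:Z *: diagn m hi.
  apply/matrixP => i j; rewrite !mxE mulrnAr -mulrnDl; congr (_ *+ _).
  rewrite /low /hi; case: ltnP => ik; first by rewrite mulr0 addr0.
  by rewrite add0r -PoszM mulnC divnK // s_chain.
have tE : mxsub f f (diagn m t *m E) = (t k)%:Z%:M.
  apply/matrixP => i j; rewrite mulmx_diagn !mxE; congr (_ *+ _).
  by rewrite mulnC divnK //; apply: t_chain; rewrite -ltnS; exact: ltn_ord i.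
pose Z := mxsub f f (X *m diagn m hi *m (Y *m E)).
have det0 : \det ((t k)%:Z%:M - (s k)%:Z *: Z) = 0.
  have -> : (t k)%:Z%:M - (s k)%:Z *: Z = mxsub f f (X *m diagn m low *m (Y *m E)).
    have -> : diagn m low = diagn m s - (s k)%:Z *: diagn m hi by rewrite lowhi addrK.
    rewrite mulmxBr mulmxBl -scalemxAr -scalemxAl /Z.
    rewrite [X *m diagn m s *m (Y *m E)]mulmxA -tXsY -tE.
    move: (diagn m t *m E) (X *m diagn m hi *m (Y *m E)) => P Q.
    by apply/matrixP => i j; rewrite !mxE.
  have low_chain i j : (i <= j)%N -> (low i %| low j)%N.
    rewrite /low => ij; case: (ltnP j k) => jk //.
    by rewrite (leq_ltn_trans ij jk) s_chain.
  (* [low] is 0 at [k], so the product of its first [k.+1] entries is 0, and only 0 is divisible by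
     it. *)
  have := @prod_dvdn_minors_diagn m k.+1 low low_chain.
  rewrite big_ord_recr /= {2}/low ltnn muln0 => /(dvdn_minors_mul X (Y *m E)).
  by move=> /dvdn_minorsP/(_ f f); rewrite dvd0z => /eqP.
(* The determinant alone would only give that [s k] divides a power of [t k]; for the coprime
   quotients [g'] and [h'] this forces [g' = 1]. *)
pose d := gcdn (t k) (s k).
have d0 : (0 < d)%N by rewrite gcdn_gt0 lt0n tk_neq0.
have [dt ds] : (d %| t k)%N /\ (d %| s k)%N by rewrite dvdn_gcdl dvdn_gcdr.
pose h' := (t k %/ d)%N; pose g' := (s k %/ d)%N.
have {}det0 : \det (h'%:Z%:M - g'%:Z *: Z) = 0.
  apply: (mulfI (x := d%:Z ^+ k.+1)); first by rewrite expf_neq0 // eqz_nat -lt0n.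
  rewrite mulr0 -det0 -detZ; congr (\det _).
  rewrite scalerBr scalerA scale_scalar_mx -!PoszM.
  by rewrite [(d * _)%N]mulnC divnK // [(d * _)%N]mulnC divnK.
have : (g'%:Z %| h'%:Z ^+ k.+1)%Z.
  rewrite -det_scalar -[X in (_ %| X)%Z]subr0 -det0.
  by apply: det_congr => i j; rewrite !mxE opprB addrC subrK dvdz_mulr.
rewrite dvdzE abszX /= => g'h'.
have /eqP co : coprime g' (h' ^ k.+1).
  rewrite coprimeXr // coprime_sym /coprime -(eqn_pmul2r d0) mul1n.
  by rewrite muln_gcdl !divnK.
have g'1 : g' = 1%N by rewrite -co; apply/esym/gcdn_idPl.
by rewrite -(divnK ds) -/g' g'1 mul1n.
Qed.

(** * Smith forms *)

Definition smith_diag (m : nat) (S : 'M[int]_m) (i : nat) : nat :=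
  oapp (fun j => `|S j j|%N) 0%N (insub i).

Lemma smith_formE (m : nat) (M S : 'M[int]_m) :
  is_smith_form M S -> dvd_chain m (smith_diag S) /\ S = diagn m (smith_diag S).
Proof.
move=> [/is_diag_mxP S_diag S_chain S_ge0 _]; split; last first.
  apply/matrixP => i j; rewrite !mxE /smith_diag valK /=.
  have [<-|ij] := eqVneq i j; last by rewrite S_diag.
  by rewrite mulr1n gez0_abs.
have S0 i : (m <= i)%N -> smith_diag S i = 0%N.
  by move=> mi; rewrite /smith_diag insubF // ltnNge mi.
split=> // i j /subnKC <-; elim: (j - i)%N => [|l IH]; first by rewrite addn0.
apply: dvdn_trans IH _; rewrite addnS.
have [lt_m|] := ltnP (i + l).+1 m; last by move=> /S0 ->; rewrite dvdn0.
rewrite /smith_diag (insubT (fun i => i < m)%N lt_m).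
rewrite (insubT (fun i => i < m)%N (ltnW lt_m)) /=.
exact: S_chain.
Qed.

Lemma unimodular_unitmx (m : nat) (U : 'M[int]_m) : unimodular U -> U \in unitmx.
Proof. by rewrite unitmxE => -[] ->; rewrite ?unitrN ?unitr1. Qed.

Lemma content_minors_smith (m k : nat) (M S : 'M[int]_m) :
  is_smith_form M S ->
  mx_content (minors_mx k M) = (\prod_(i < k) smith_diag S i)%N.
Proof.
move=> MS; have [[S_chain S0] SE] := smith_formE MS.
rewrite -(content_minors_diagn k S_chain S0) -SE.
have [_ _ _ [U [V [/unimodular_unitmx uU /unimodular_unitmx uV ->]]]] := MS.
apply/eqP; rewrite eqn_dvd; apply/andP; split; last exact: dvdn_minors_mul.
rewrite -{2}[S](mulKmx uU) -[X in invmx U *m X](mulmxK uV) mulmxA.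
exact: dvdn_minors_mul.
Qed.

(** Since [A ^+ n.+1] is [A] times [A ^+ n], [S'] is [S] multiplied by integer matrices on both
    sides. This makes the quotients in the theorem exact. *)
Lemma smith_diag_expr_dvd (m n k : nat) (A : 'M[int]_m) (S S' : 'M[int]_m) :
  is_smith_form (A ^+ n) S -> is_smith_form (A ^+ n.+1) S' ->
  (smith_diag S k %| smith_diag S' k)%N.
Proof.
move=> AS AS'; have [cS SE] := smith_formE AS; have [cS' SE'] := smith_formE AS'.
have [_ _ _ [U [V [_ _ AUV]]]] := AS.
have [_ _ _ [U' [V' [/unimodular_unitmx uU /unimodular_unitmx uV AUV']]]] := AS'.
apply: (@dvd_chain_mul m k _ _ (invmx U' *m A *m U) (V *m invmx V') cS cS').
rewrite -SE -SE'; have -> : S' = invmx U' *m (A ^+ n.+1) *m invmx V'.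
  by rewrite AUV' !mulmxA mulVmx // mul1mx mulmxK.
by rewrite exprS -mulmxE AUV !mulmxA.
Qed.

Lemma prod_smith_diag_geometric (m k : nat) (A : 'M[int]_m) (S : nat -> 'M[int]_m) :
  (forall n, is_smith_form (A ^+ n) (S n)) ->
  exists n0 T, (0 < T)%N /\
    geometric_along (fun n => \prod_(i < k) smith_diag (S n) i)%N n0 T.
Proof.
move=> hS; have [n0 [T [T0 [c1 [c2 [c1_gt0 c2_gt0 cT]]]]]] :=
  content_expr_geometric (minors_mx k A).
(* The power of the factorial balances those in [minors_mxX]; the shift to [n0.+1] avoids exponent
   0. *)
exists n0.+1, T; split=> //; exists (c1 * k`! ^ T)%N, c2.
split=> // [|[//|n] n0n]; first by rewrite muln_gt0 c1_gt0 expn_gt0 fact_gt0.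
have := cT n.+1 (ltnW n0n); rewrite addSn !minors_mxX !mx_contentZ.
rewrite !(content_minors_smith k (hS _)) expnD => E.
have fn_gt0 : (0 < k`! ^ n)%N by rewrite expn_gt0 fact_gt0.
apply/eqP; rewrite -(eqn_pmul2l fn_gt0) (mulnCA _ c2) -E; apply/eqP; ring.
Qed.

(** Entry [k] is a ratio of consecutive products. If it is nonzero at [n], so is the shorter
    product, by the chain; if it is zero, it stays zero for larger [n]. *)
Lemma prod_ratio_geometric (n0 T k : nat) (s : nat -> nat -> nat) :
  (forall n i, (s n i %| s n.+1 i)%N) ->
  (forall n i j, (i <= j)%N -> (s n i %| s n j)%N) ->
  geometric_along (fun n => \prod_(i < k) s n i)%N n0 T ->
  geometric_along (fun n => \prod_(i < k.+1) s n i)%N n0 T ->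
  geometric_along (s^~ k) n0 T.
Proof.
move=> s_dvd s_chain [c1 [c2 [c1_gt0 c2_gt0 cP]]] [d1 [d2 [d1_gt0 d2_gt0 dP]]].
exists (d1 * c2)%N, (d2 * c1)%N; rewrite !muln_gt0 c1_gt0 c2_gt0 d1_gt0 d2_gt0.
split=> // n n0n; have [sn0|sn_neq0] := posnP (s n k).
  have -> : s (n + T)%N k = 0%N; last by rewrite sn0 !muln0.
  apply/eqP; rewrite -dvd0n -sn0.
  by elim: (T) => [|l IH]; rewrite ?addn0 ?addnS // (dvdn_trans IH).
have P_gt0 : (0 < \prod_(i < k) s n i)%N.
  rewrite prodn_gt0 // => i; rewrite lt0n; apply: contraL sn_neq0 => /eqP sni0.
  by have := s_chain n i k (ltnW (ltn_ord i)); rewrite sni0 dvd0n -leqn0 -ltnNge ltnS.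
have := cP n n0n; have := dP n n0n; rewrite !big_ord_recr /=.
move: (\prod_(i < k) s n i)%N P_gt0 (\prod_(i < k) s (n + T)%N i)%N => P P_gt0 P' E1 E2.
apply/eqP; rewrite -(eqn_pmul2r P_gt0).
apply/eqP; transitivity (d1 * s (n + T) k * (c2 * P))%N; first by ring.
rewrite -E2; transitivity (c1 * (d1 * (P' * s (n + T) k)))%N; first by ring.
by rewrite E1; ring.
Qed.

(** Scaling both terms by [c1] or [c2] preserves the quotient, even when it is a division by 0. *)
Lemma divn_geometric_periodic (u : nat -> nat) (n0 T n : nat) :
  geometric_along u n0 T -> (n0 <= n)%N ->
  (u (n + T).+1 %/ u (n + T) = u n.+1 %/ u n)%N.
Proof.
move=> [c1 [c2 [c1_gt0 c2_gt0 uT]]] n0n.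
rewrite -(@divnMl c1) // -(@divnMl c2 (u n.+1)) // uT // -addSn uT //.
exact: leqW.
Qed.

Theorem theorem1p1 (m : nat) (A : 'M[int]_m) (S : nat -> 'M[int]_m)
    (hS : forall n : nat, is_smith_form (A ^+ n) (S n)) :
  exists D : nat -> 'M[int]_m,
    [/\ eventually_periodic D,
        forall n : nat, is_diag_mx (D n)
      & forall n : nat, S n.+1 = D n *m S n].
Proof.
pose s n := smith_diag (S n).
have SE n : S n = diagn m (s n) := (smith_formE (hS n)).2.
have s_dvd n i : (s n i %| s n.+1 i)%N := smith_diag_expr_dvd i (hS n) (hS n.+1).
have s_chain n i j : (i <= j)%N -> (s n i %| s n j)%N.
  by have [[chain _] _] := smith_formE (hS n); exact: chain.
(* Where [s n i = 0], also [s n.+1 i = 0], so the default quotient 0 is correct. *)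
exists (fun n => diagn m (fun i => s n.+1 i %/ s n i)%N); split; last first.
- move=> n; rewrite !SE mulmx_diagn; congr diag_mx.
  by apply/rowP => i; rewrite !mxE divnK.
- by move=> n; exact: diag_mx_is_diag.
pose Q k n0 T := geometric_along (fun n => \prod_(i < k) s n i)%N n0 T.
(* Entry [i < m] needs the products of lengths [i] and [i.+1], hence all lengths from 0 to [m]. *)
have [k0 k1 k T l|k _|n0 [T [T_gt0 PT]]] := @common_period _ (iota 0 m.+1) Q.
- exact: geometric_alongM.
- exact: prod_smith_diag_geometric.
exists n0, T; split=> // n n0n; congr diag_mx; apply/rowP => i; rewrite !mxE.
have sT : geometric_along (s^~ i) n0 T.
  by apply: prod_ratio_geometric => //; apply: PT;
     rewrite mem_iota; have := ltn_ord i; lia.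
congr Posz; exact: (divn_geometric_periodic sT n0n).
Qed.
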